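(* Let $c_0$ be the unique solution in $(1,\infty)$ of the equation $(t+1)\ln(t+1)+(t-1)\ln(t-1)=2t$. 1. Let $r\colon\mathbb{R}\to(0,\infty)$ and $M>0$ be such that $$r(x)\le c_0|x|+M\qquad\text{for all }x\in\mathbb{R}\setminus[-M,M].$$ Then every lower semicontinuous $(\lambda,r)$-supermedian function $f\colon\mathbb{R}\to(-\infty,\infty]$ which is lower bounded, or which satisfies $\liminf_{|x|\to\infty}f(x)/\ln|x|\ge 0$, is constant. 2. If, however, $c>c_0$, $M>0$, and $r(x):=\max\{c|x|,M\}$ for $x\in\mathbb{R}$, then for all sufficiently small $\alpha>0$ (that is, there exists $\alpha_0>0$ such that for every $\alpha\in(0,\alpha_0]$) the function $r^{-\alpha}\colon x\mapsto r(x)^{-\alpha}$ on $\mathbb{R}$ is $(\lambda,r)$-supermedian.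
   Context: For $x\in\mathbb{R}$, $\rho>0$ and a function $f$ on $\mathbb{R}$, $\lambda_{x,\rho}(f):=\frac1{2\rho}\int_{x-\rho}^{x+\rho}f(s)\,ds$ is the average of $f$ on the interval $[x-\rho,x+\rho]$. Given $r\colon\mathbb{R}\to(0,\infty)$ (no regularity of $r$ is assumed), a function $f$ is called $(\lambda,r)$-supermedian if $\lambda_{x,r(x)}(f)\le f(x)$ for every $x\in\mathbb{R}$. A lower semicontinuous function with values in $(-\infty,\infty]$ is bounded below on compact sets, so these averages are well defined in $(-\infty,\infty]$. ''Constant'' allows the constant value $+\infty$. *)

(* Defs.v *)
From HB Require Import structures.
From mathcomp Require Import all_boot all_order all_algebra.
From mathcomp Require Import all_classical all_reals all_analysis.

Set Implicit Arguments.
Unset Strict Implicit.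
Unset Printing Implicit Defensive.

Import Order.TTheory GRing.Theory Num.Theory.
Import numFieldNormedType.Exports.

Local Open Scope classical_set_scope.
Local Open Scope ring_scope.

(* The integral is that of the positive part minus that of the negative part,
   which is the usual (-oo, +oo]-valued one for f lower semicontinuous
   and > -oo. *)
Definition interval_average (R : realType) (x rho : R) (f : R -> \bar R) :
    \bar R :=
  (((2 * rho)^-1)%:E *
   \int[lebesgue_measure]_(s in `[(x - rho)%R, (x + rho)%R]) f s)%E.

Definition supermedian (R : realType) (r : R -> R) (f : R -> \bar R) : Prop :=
  forall x : R, (interval_average x (r x) f <= f x)%E.

Definition norm_pinfty_nbhs (R : realType) : set_system R :=
  filter_from [set: R] (fun A : R => [set x : R | A < `|x|]).
Arguments norm_pinfty_nbhs : clear implicits.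

Definition critical_equation (R : realType) (t : R) : Prop :=
  (t + 1) * ln (t + 1) + (t - 1) * ln (t - 1) = 2 * t.

(* Main.v *)
Require Import Defs.
From mathcomp Require Import all_boot all_order all_algebra.
From mathcomp Require Import all_classical all_reals all_analysis.
From mathcomp Require Import measurable_realfun ring lra.

Import Order.TTheory GRing.Theory Num.Theory.
Import numFieldNormedType.Exports.

Local Open Scope classical_set_scope.
Local Open Scope ring_scope.

(** The average of [ln |s|] over the interval of radius [t * |x|] centred at
    [x], with [t > 1], is [ln |x| + g t / (2 * t)], where
    [g t = (t + 1) ln (t + 1) + (t - 1) ln (t - 1) - 2 t] is [log_excess].  The
    function [g] is negative on [(1, 2]], increasing on [[2, +oo)], and its
    zero [c0] lies between 2 and 3.  So averaging over radii at most [c0 |x|]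
    does not increase the logarithm, while a radius [c |x|] with [c > c0]
    increases it by a positive constant.

    At slope [c0] the logarithm serves as a barrier.  Radii are only bounded by
    [c0 |x| + M], so some slack is needed: [h s = ln (1 + |s|) - 2 / (1 + |s|)]
    has averages strictly below [h x] as soon as [|x|] is large
    ([barrier_integral_lt]), because the average of [2 / (1 + |s|)] exceeds its
    value at [x] by a term of order [ln |x| / |x|], which outweighs both the
    cost of replacing [ln |s|] by [ln (1 + |s|)] and errors of order
    [1 / |x|].  Now let [f] be supermedian with [f >= - e ln |s|] at
    infinity for every [e > 0].  Then [f + e h] is lower semicontinuous and
    tends to [+oo], hence attains its minimum, and by strictness only in a
    fixed compact set [K].  Letting [e] tend to 0 shows that [f] is at least
    its minimum [m] over [K] ([supermedian_ge_min]).  Where [f = m], the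
    average of [f - m >= 0] vanishes, so by lower semicontinuity [f = m] on the
    whole open interval of averaging; thus [{f = m}] is open and closed, and
    [f] is constant ([supermedian_min_constant]).

    At slope [c > c0], put [T] uniform on [[1 - c, 1 + c]].  The mean of
    [|T| ^ (- alpha)] is [1 - alpha E(ln |T|) + O(alpha ^ 2)], and [E(ln |T|)]
    has the sign of [g c > 0], so that mean is at most 1 for small [alpha]
    ([powR_average_le]).  By scaling this is the supermedian inequality for
    [(c |x|) ^ (- alpha)], and truncating that function near the origin only
    lowers its averages ([power_profile_supermedian]). *)

(** * The critical constant *)

Section Scalars.
Context {R : realType}.
Implicit Types t s x y z w : R.

Lemma ln_le_subr1 x : 0 < x -> ln x <= x - 1.
Proof.
move=> x0; have := @le_ln1Dx R (x - 1).
rewrite (_ : 1 + (x - 1) = x); last by ring.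
by apply; lra.
Qed.

(** Convexity of [z ln z]; it comes down to [ln (w / z) <= w / z - 1]. *)
Lemma xlnx_tangent z w : 0 < z -> 0 < w ->
  (1 + ln w) * (z - w) <= z * ln z - w * ln w.
Proof.
move=> z0 w0.
have : ln (w / z) <= w / z - 1 by apply: ln_le_subr1; rewrite divr_gt0.
rewrite ln_div ?posrE// => H.
have : z * (ln w - ln z) <= z * (w / z - 1) by rewrite ler_pM2l.
rewrite (_ : z * (w / z - 1) = w - z); last by field; rewrite gt_eqF.
by lra.
Qed.

(** From [exp (1/3) >= 4/3]: [exp (4/3) >= (4/3) ^ 4 > 3]. *)
Lemma ln3_lt : ln (3 : R) < 4 / 3.
Proof.
have e : 4 / 3 <= expR (1 / 3 : R) by have := expR_ge1Dx (1 / 3 : R); lra.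
have h : (4 / 3 : R) ^+ 4 <= expR (1 / 3) ^+ 4.
  by rewrite lerXn2r// nnegrE; [lra|exact: expR_ge0].
rewrite -expRM_natl in h.
rewrite -[4/3 in ltRHS]expRK ltr_ln ?posrE ?expR_gt0//.
rewrite (_ : 4 / 3 = 4%:R * (1 / 3)); last by field.
apply: lt_le_trans h; lra.
Qed.

(** From [exp (- 1/10) >= 9/10]: [exp (- 3/5) >= (9/10) ^ 6 > 1/2]. *)
Lemma ln2_gt : 3 / 5 < ln (2 : R).
Proof.
have e : 9 / 10 <= expR (- (1 / 10) : R).
  by have := expR_ge1Dx (- (1 / 10) : R); lra.
have h : (9 / 10 : R) ^+ 6 <= expR (- (1 / 10)) ^+ 6.
  by rewrite lerXn2r// nnegrE; [lra|exact: expR_ge0].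
rewrite -expRM_natl in h.
have : ln (2^-1 : R) < - (3 / 5).
  rewrite -[- (3 / 5) in ltRHS]expRK ltr_ln ?posrE ?expR_gt0//.
  rewrite (_ : - (3 / 5) = 6%:R * - (1 / 10)); last by field.
  apply: lt_le_trans h; lra.
rewrite lnV ?posrE//; lra.
Qed.

(** Up to the factor [2 t], the mean of [ln |s|] over [[1 - t, 1 + t]]. *)
Definition log_excess t := (t + 1) * ln (t + 1) + (t - 1) * ln (t - 1) - 2 * t.

Lemma log_excess_eq0 t : critical_equation t <-> log_excess t = 0.
Proof. by rewrite /critical_equation /log_excess; split=> H; lra. Qed.

(** Convexity again: the slope at [s] is [ln (s + 1) + ln (s - 1)], since the
    constant contributions [1 + 1 - 2] cancel. *)
Lemma log_excess_tangent t s : 1 < t -> 1 < s ->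
  (t - s) * (ln (s + 1) + ln (s - 1)) <= log_excess t - log_excess s.
Proof.
move=> t1 s1; rewrite /log_excess.
have := @xlnx_tangent (t + 1) (s + 1) ltac:(lra) ltac:(lra).
have := @xlnx_tangent (t - 1) (s - 1) ltac:(lra) ltac:(lra).
lra.
Qed.

(** The second summand is nonpositive.  For the first, the tangent of [ln] at 3
    and [ln 3 < 4 / 3] bound [ln (t + 1)] by [(t + 2) / 3], and
    [(t + 1) (t + 2) / 3 <= 2 t] amounts to [(t - 1) (t - 2) <= 0]. *)
Lemma log_excess_lt0 t : 1 < t -> t <= 2 -> log_excess t < 0.
Proof.
move=> t1 t2; rewrite /log_excess.
have h1 : (t - 1) * ln (t - 1) <= 0.
  by apply: mulr_ge0_le0; [lra|apply: ln_le0; lra].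
have h2 : ln ((t + 1) / 3) <= (t + 1) / 3 - 1 by apply: ln_le_subr1; lra.
rewrite ln_div ?posrE in h2; [|lra|lra].
have := ln3_lt => h3.
have h4 : ln (t + 1) < (t + 2) / 3 by lra.
have : (t + 1) * ln (t + 1) < (t + 1) * ((t + 2) / 3) by rewrite ltr_pM2l; lra.
have : 0 <= (t - 1) * (2 - t) by apply: mulr_ge0; lra.
lra.
Qed.

Lemma log_excess_lt s t : 2 <= s -> s < t -> log_excess s < log_excess t.
Proof.
move=> s2 st.
have := @log_excess_tangent t s ltac:(lra) ltac:(lra).
have l1 : 0 < ln (s + 1) by apply: ln_gt0; lra.
have l2 : 0 <= ln (s - 1) by apply: ln_ge0; lra.
have : 0 < (t - s) * (ln (s + 1) + ln (s - 1)) by apply: mulr_gt0; lra.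
lra.
Qed.

Lemma log_excess3_gt0 : 0 < log_excess 3.
Proof.
rewrite /log_excess (_ : 3 + 1 = 2 * 2); last by ring.
rewrite (_ : 3 - 1 = 2); last by ring.
rewrite lnM ?posrE//; have := ln2_gt; lra.
Qed.

Lemma continuous_log_excess t : 1 < t -> {for t, continuous log_excess}.
Proof.
move=> t1.
have c1 : {for t, continuous (fun s : R => s + 1)}.
  by apply: continuousD; [exact: cvg_id|exact: cvg_cst].
have c2 : {for t, continuous (fun s : R => s - 1)}.
  by apply: continuousB; [exact: cvg_id|exact: cvg_cst].
apply: continuousB; last first.
  by apply: continuousM; [exact: cvg_cst|exact: cvg_id].
apply: continuousD; apply: continuousM => //.
  by apply: (continuous_comp c1); apply: continuous_ln; lra.
by apply: (continuous_comp c2); apply: continuous_ln; lra.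
Qed.

Lemma critical_root :
  exists c0 : R, [/\ 2 < c0, c0 < 3 & log_excess c0 = 0].
Proof.
have c23 : {within `[2, 3], continuous log_excess}.
  apply: continuous_in_subspaceT => x; rewrite inE/= in_itv/= => /andP[x2 x3].
  by apply: continuous_log_excess; lra.
have n2 := @log_excess_lt0 2 ltac:(lra) ltac:(lra).
have p3 := log_excess3_gt0.
have z23 : Order.min (log_excess 2) (log_excess 3) <= 0 <=
           Order.max (log_excess 2) (log_excess 3 : R).
  by rewrite ge_min le_max (ltW n2) (ltW p3) orbT.
have [c0] := @IVT R log_excess 2 3 0 ltac:(lra) c23 z23.
rewrite in_itv/= => /andP[c2 c3] c0E; exists c0; split => //.
- rewrite lt_neqAle c2 andbT; apply/eqP => E; move: n2; rewrite E c0E; lra.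
- rewrite lt_neqAle c3 andbT; apply/eqP => E; move: p3; rewrite -E c0E; lra.
Qed.

End Scalars.

(** * The barrier and its averages *)

Section Barrier.
Context {R : realType}.
Implicit Types a t s x y z w rho : R.

(** The barrier is [barrier `|s|].  Passing from [ln |s|] to [ln (1 + |s|)]
    raises the integral over a large interval around 0 by about twice the
    logarithm of its length; a multiple [a / (1 + |s|)] lowers it by about [a]
    times as much, so that any [a > 1] leaves a gain.  With [a = 2] the
    primitive has a simple form. *)
Definition barrier y := ln (1 + y) - 2 / (1 + y).
(** The primitive of [barrier] that vanishes at 0. *)
Definition barrier_prim y := (y - 1) * ln (1 + y) - y.
(** The integral of [barrier `|s|] over [[x - rho, x + rho]] for [x >= 0]: the
    interval contains 0 in the second case and is folded there. *)
Definition barrier_integral x rho :=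
  if rho <= x then barrier_prim (x + rho) - barrier_prim (x - rho)
  else barrier_prim (rho + x) + barrier_prim (rho - x).

Lemma is_derive_addl a y : is_derive y 1 (fun z => a + z) 1.
Proof.
by have := is_deriveD (is_derive_cst a y 1) (is_derive_id y 1); rewrite add0r.
Qed.

Lemma is_derive_subl a y : is_derive y 1 (fun z => a - z) (-1).
Proof.
by have := is_deriveB (is_derive_cst a y 1) (is_derive_id y 1); rewrite sub0r.
Qed.

Lemma is_derive_barrier_prim y : -1 < y ->
  is_derive y 1 barrier_prim (barrier y).
Proof.
move=> y1.
have y0 : 0 < 1 + y by lra.
have dl : is_derive y 1 (fun z : R => ln (1 + z)) (1 + y)^-1.
  have d1 : is_derive y 1 (fun z : R => 1 + z) 1 by exact: is_derive_addl.
  have d2 : is_derive (1 + y) 1 (@ln R) (1 + y)^-1 by exact: is_derive1_ln.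
  have := @is_derive1_comp R (@ln R) (fun z : R => 1 + z) y _ _ d2 d1.
  by rewrite mulr1.
have := is_deriveB (is_deriveM (is_deriveB (is_derive_id y 1)
  (is_derive_cst (1 : R) y 1)) dl) (is_derive_id y 1).
move/is_derive_eq; apply; rewrite /barrier /GRing.scale/= !fctE.
by field; rewrite gt_eqF.
Qed.

(** Strict concavity of [barrier] at midpoints: both [ln] and [- 1 / z] are
    strictly concave. *)
Lemma barrier_midpoint x s : 0 < s -> s < 1 + x ->
  barrier (x + s) + barrier (x - s) < 2 * barrier x.
Proof.
move=> s0 sx; rewrite /barrier.
set X := 1 + x; rewrite !addrA -/X.
have Xs : 0 < X - s by rewrite /X; lra.
have X0 : 0 < X by rewrite /X; lra.
have XXs : 0 < X + s by lra.
have l : ln (X + s) + ln (X - s) < 2 * ln X.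
  rewrite -lnM ?posrE// mulr_natl -lnXn// ltr_ln ?posrE ?mulr_gt0 ?exprn_gt0//.
  rewrite -subr_gt0 (_ : _ - _ = s ^+ 2) ?exprn_gt0//; ring.
have e : 0 < 2 / (X + s) + 2 / (X - s) - 4 / X.
  rewrite (_ : _ - _ = 4 * s ^+ 2 / ((X + s) * (X - s) * X)); last first.
    by field; rewrite !gt_eqF.
  by apply: divr_gt0; rewrite !mulr_gt0// exprn_gt0.
lra.
Qed.

(** If the interval avoids 0, concavity applies: as a function of the radius,
    the gap between the two sides vanishes at 0 and has derivative
    [2 barrier x - barrier (x + s) - barrier (x - s) > 0]. *)
Lemma barrier_integral_concave x rho : 0 < rho -> rho <= x ->
  barrier_prim (x + rho) - barrier_prim (x - rho) < 2 * rho * barrier x.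
Proof.
move=> r0 rx.
pose phi s := 2 * s * barrier x - (barrier_prim (x + s) - barrier_prim (x - s)).
pose dphi s := 2 * barrier x - (barrier (x + s) + barrier (x - s)).
have dphiP s : s \in `[0, rho] -> is_derive s 1 phi (dphi s).
  rewrite in_itv/= => /andP[s0 sr].
  have d1 : is_derive s 1 (fun z : R => barrier_prim (x + z)) (barrier (x + s)).
    have e : is_derive s 1 (fun z : R => x + z) 1 by exact: is_derive_addl.
    have d := @is_derive_barrier_prim (x + s) ltac:(lra).
    have := @is_derive1_comp R barrier_prim (fun z : R => x + z) s _ _ d e.
    by rewrite mulr1.
  have d2 : is_derive s 1 (fun z : R => barrier_prim (x - z)) (- barrier (x - s)).
    have e : is_derive s 1 (fun z : R => x - z) (-1) by exact: is_derive_subl.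
    have d := @is_derive_barrier_prim (x - s) ltac:(lra).
    have := @is_derive1_comp R barrier_prim (fun z : R => x - z) s _ _ d e.
    by rewrite mulrN1.
  have := is_deriveB (is_deriveM (is_deriveM (is_derive_cst (2 : R) s 1)
    (is_derive_id s 1)) (is_derive_cst (barrier x) s 1)) (is_deriveB d1 d2).
  move/is_derive_eq; apply.
  by rewrite /dphi /GRing.scale/= !fctE; ring.
have cphi : {within `[0, rho], continuous phi}.
  apply: derivable_within_continuous => s sI.
  by have [] := dphiP _ sI.
have [s] := MVT r0 (fun s sI => dphiP s (subset_itv_oo_cc sI)) cphi.
rewrite in_itv/= => /andP[s0 sr] E.
have : 0 < dphi s * (rho - 0).
  rewrite subr0 mulr_gt0// /dphi subr_gt0; apply: barrier_midpoint; lra.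
rewrite -E /phi !addr0 !subr0; lra.
Qed.

(** A transitional range: for [rho] close to [x] the logarithm alone leaves a
    gap of order [x], as [log_excess 1 = 2 ln 2 - 2 < 0], so crude bounds are
    enough. *)
Lemma barrier_integral_near x rho : expR 4 <= x -> x < rho -> rho <= 1 + x ->
  barrier_prim (rho + x) + barrier_prim (rho - x) < 2 * rho * barrier x.
Proof.
move=> ex xr rx; rewrite /barrier_prim /barrier.
have x5 : 5 <= x by apply: le_trans ex; have := expR_ge1Dx (4 : R); lra.
have lX : 4 < ln (1 + x).
  by rewrite -[ltLHS]expRK ltr_ln ?posrE ?expR_gt0//; lra.
have h1 : (rho - x - 1) * ln (1 + (rho - x)) <= 0.
  by apply: mulr_le0_ge0; [lra|apply: ln_ge0; lra].
have l2 : ln (2 : R) <= 1 by have := @ln_le_subr1 R 2 ltac:(lra); lra.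
have h2 : ln (1 + (rho + x)) <= 1 + ln (1 + x).
  apply: (@le_trans _ _ (ln (2 * (1 + x)))).
    by rewrite ler_ln ?posrE; lra.
  by rewrite lnM ?posrE; lra.
have h3 : (rho + x - 1) * ln (1 + (rho + x)) <= (rho + x - 1) * (1 + ln (1 + x)).
  by rewrite ler_pM2l; lra.
have h4 : (rho - x + 1) * 4 < (rho - x + 1) * ln (1 + x).
  by rewrite ltr_pM2l; lra.
have h5 : rho * (2 / (1 + x)) <= 2.
  rewrite mulrA ler_pdivrMr; lra.
lra.
Qed.

(** A slope exceeding [c0] by at most [M / X] makes [log_excess] positive by at
    most [O(1 / X)], which after multiplication by [X] stays bounded. *)
Lemma log_excess_le c0 M X rho : 2 < c0 -> c0 < 3 -> log_excess c0 = 0 ->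
  0 < M -> 1 <= X -> X < rho -> rho <= c0 * X + M ->
  X * log_excess (rho / X) <= 2 * M * (3 + M).
Proof.
move=> c2 c3 c0E M0 X1 Xr rM.
have X0 : 0 < X by lra.
set t := rho / X.
have tX : rho = t * X by rewrite /t divfK// gt_eqF.
have t1 : 1 < t by rewrite /t ltr_pdivlMr// mul1r.
have tM : t - c0 <= M / X by rewrite ler_pdivlMr// mulrBl -tX; lra.
have MX : M / X <= M by rewrite ler_pdivrMr// ler_peMr; lra.
have C0 : 0 <= 2 * M * (3 + M) by rewrite !mulr_ge0//; lra.
have [t2|t2] := leP t 2.
  apply: le_trans C0; apply: mulr_ge0_le0; first lra.
  by apply/ltW/log_excess_lt0.
have := @log_excess_tangent R c0 t ltac:(lra) t1; rewrite c0E => H.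
have [tc|tc] := leP t c0.
  apply: le_trans C0; apply: mulr_ge0_le0; first lra.
  have : 0 <= (c0 - t) * (ln (t + 1) + ln (t - 1)).
    by apply: mulr_ge0; [lra|apply: addr_ge0; apply: ln_ge0; lra].
  lra.
have l1 := @ln_le_subr1 R (t + 1) ltac:(lra).
have l2 := @ln_le_subr1 R (t - 1) ltac:(lra).
have XtM : X * (t - c0) <= M by rewrite mulrC -ler_pdivlMr.
have Xt0 : 0 <= X * (t - c0) by rewrite mulr_ge0//; lra.
apply: (@le_trans _ _ (X * (t - c0) * (2 * (3 + M)))); last first.
  by rewrite [2 * M]mulrC -[M * 2 * _]mulrA ler_wpM2r//; lra.
apply: (@le_trans _ _ (X * (t - c0) * (ln (t + 1) + ln (t - 1)))).
  by rewrite -mulrA ler_pM2l//; lra.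
by rewrite ler_wpM2l//; lra.
Qed.

(** The main range.  With [X = 1 + x] the integral is [2 rho ln X], plus
    [X * log_excess (rho / X)], minus [2 ln (rho + X)], up to a bounded error.
    The second term is bounded by [log_excess_le] and the third one tends to
    [-oo], whence the exponential lower bound on [x]. *)
Lemma barrier_integral_far c0 M x rho :
  2 < c0 -> c0 < 3 -> log_excess c0 = 0 -> 0 < M ->
  expR (2 * M * (3 + M) + 4 * M + 14) <= x ->
  1 + x < rho -> rho <= c0 * x + M ->
  barrier_prim (rho + x) + barrier_prim (rho - x) < 2 * rho * barrier x.
Proof.
move=> c2 c3 c0E M0 ex xr rx; rewrite /barrier_prim /barrier.
have x1 : 1 <= x.
  apply: le_trans ex; rewrite -[leLHS]expR0 ler_expR.
  by rewrite !addr_ge0// !mulr_ge0//; lra.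
have lX : 2 * M * (3 + M) + 4 * M + 14 <= ln x.
  by rewrite -[leLHS]expRK ler_ln ?posrE ?expR_gt0//; lra.
have lr : ln x <= ln (1 + (rho + x)) by rewrite ler_ln ?posrE; lra.
set X := 1 + x.
have -> : 1 + (rho + x) = rho + X by rewrite /X; ring.
have -> : 1 + (rho - x) = rho - X + 2 by rewrite /X; ring.
rewrite (_ : 1 + (rho + x) = rho + X) in lr; last by rewrite /X; ring.
have rX : 0 < rho - X by rewrite /X; lra.
have X0 : 0 < X by rewrite /X; lra.
have rX' : 0 < rho + X by lra.
have h1 : (rho - X) * ln (rho - X + 2) <= (rho - X) * ln (rho - X) + 2.
  have : ln ((rho - X + 2) / (rho - X)) <= 2 / (rho - X).
    apply: (le_trans (@ln_le_subr1 R _ _)); first by rewrite divr_gt0; lra.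
    by rewrite mulrDl divff ?gt_eqF//; lra.
  rewrite ln_div ?posrE//; last lra.
  rewrite -(ler_pM2l rX) mulrCA divff ?gt_eqF//; lra.
have h2 : X * log_excess (rho / X) <= 2 * M * (3 + M).
  apply: (@log_excess_le c0) => //; rewrite ?/X; [lra|].
  by rewrite mulrDr; lra.
have h3 : X * log_excess (rho / X) =
    (rho + X) * ln (rho + X) + (rho - X) * ln (rho - X) - 2 * rho
    - 2 * rho * ln X.
  rewrite /log_excess.
  have -> : rho / X + 1 = (rho + X) / X by field; rewrite gt_eqF.
  have -> : rho / X - 1 = (rho - X) / X by field; rewrite gt_eqF.
  rewrite !ln_div ?posrE//; field; rewrite gt_eqF//.
have h4 : rho * (2 / X) <= 2 * (3 + M).
  have : rho <= (3 + M) * X.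
    have := @ler_wpM2r _ x ltac:(lra) _ _ (ltW c3).
    have : M * 1 <= M * X by rewrite ler_pM2l// /X; lra.
    rewrite mulrDl /X; lra.
  by rewrite mulrA ler_pdivrMr//; lra.
have -> : (rho + x - 1) * ln (rho + X) = (rho + X) * ln (rho + X) - 2 * ln (rho + X).
  by rewrite /X; ring.
have -> : (rho - x - 1) * ln (rho - X + 2) = (rho - X) * ln (rho - X + 2).
  by rewrite /X; ring.
have C0 : 0 <= 2 * M * (3 + M) by rewrite !mulr_ge0//; lra.
lra.
Qed.

Lemma barrier_integral_lt c0 M :
  2 < c0 -> c0 < 3 -> log_excess c0 = 0 -> 0 < M ->
  exists A, forall x rho, A <= x -> 0 < rho -> rho <= c0 * x + M ->
    barrier_integral x rho < 2 * rho * barrier x.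
Proof.
move=> c2 c3 c0E M0; exists (expR (2 * M * (3 + M) + 4 * M + 14)) => x rho Ax r0 rM.
rewrite /barrier_integral.
have [rx|xr] := leP rho x; first exact: barrier_integral_concave.
have [rx|xr'] := leP rho (1 + x); last exact: (@barrier_integral_far c0 M).
apply: barrier_integral_near => //; apply: le_trans Ax; rewrite ler_expR.
suff : 0 <= 2 * M * (3 + M) by lra.
by rewrite !mulr_ge0//; lra.
Qed.

End Barrier.

(** * Integrals over segments *)

Section Integrals.
Context {R : realType}.
Local Notation mu := (@lebesgue_measure R).
Implicit Types (a b x y : R) (g k K : R -> R).

Lemma integral_segment k K a b : a <= b ->
  {in `[a, b], forall y, is_derive y 1 K (k y)} ->
  {within `[a, b], continuous k} ->
  (\int[mu]_(y in `[a, b]) (k y)%:E = (K b - K a)%:E)%E.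
Proof.
rewrite le_eqVlt => /predU1P[<-|ab] dK ck.
  by rewrite set_itv1 integral_set1 subrr.
have dK' : {in `[a, b], forall y, derivable K y 1}.
  by move=> y yab; have [] := dK _ yab.
have cK : {in `[a, b], forall y, {for y, continuous K}}.
  by move=> y yab; apply/differentiable_continuous/derivable1_diffP/dK'.
rewrite (@continuous_FTC2 _ k K a b ab ck) ?EFinB//.
- split.
  + by move=> y /subset_itv_oo_cc; exact: dK'.
  + by apply: cvg_at_right_filter; apply: cK; rewrite in_itv/= lexx ltW.
  + by apply: cvg_at_left_filter; apply: cK; rewrite in_itv/= lexx ltW.
- by move=> y /subset_itv_oo_cc yab; rewrite derive1E; have [_ ->] := dK _ yab.
Qed.

Lemma integral_segment_cst (a b p : R) : a <= b ->
  (\int[mu]_(s in `[a, b]) p%:E = (p * (b - a))%:E)%E.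
Proof.
move=> ab; rewrite integral_cst//= lebesgue_measure_itv/= lte_fin EFinM.
by move: ab; rewrite le_eqVlt => /predU1P[->|->]; rewrite ?ltxx ?subrr// EFinB.
Qed.

Lemma integrable_segment (g : R -> R) (a b : R) : continuous g ->
  mu.-integrable `[a, b] (EFin \o g).
Proof.
move=> cg; apply: continuous_compact_integrable; first exact: segment_compact.
exact: continuous_subspaceT.
Qed.

Lemma integral_even_opp g a b : a <= b -> continuous g ->
  (forall s, g (- s) = g s) ->
  (\int[mu]_(s in `[(- b)%R, (- a)%R]) (g s)%:E =
   \int[mu]_(s in `[a, b]) (g s)%:E)%E.
Proof.
move=> ab cg ge; rewrite (integration_by_substitution_oppr ab).
  by apply: eq_integral => s _ /=; rewrite ge.
exact: continuous_subspaceT.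
Qed.

Lemma integral_segment_split g a z b : a <= z -> z <= b -> continuous g ->
  (\int[mu]_(s in `[a, b]) (g s)%:E =
   \int[mu]_(s in `[a, z]) (g s)%:E + \int[mu]_(s in `[z, b]) (g s)%:E)%E.
Proof.
move=> az zb cg.
have mg : measurable_fun [set: R] (EFin \o g).
  by apply/measurable_EFinP; exact: continuous_measurable_fun.
rewrite -[in X in (_ = _ + X)%E]integral_itv_obnd_cbnd; last exact: measurable_funTS.
rewrite (@itv_bndbnd_setU _ _ (BLeft a) (BRight z) (BRight b)) ?bnd_simp//.
rewrite integral_setU//; first exact: measurable_funTS.
apply/disj_setPRL => s /=; rewrite !in_itv/= => /andP[zs _] /andP[_].
by rewrite leNgt zs.
Qed.

(** An interval containing 0 is cut there and its left part reflected. *)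
Lemma integral_even_split g x rho : 0 <= x -> x <= rho -> continuous g ->
  (forall s, g (- s) = g s) ->
  (\int[mu]_(s in `[(x - rho)%R, (x + rho)%R]) (g s)%:E =
   \int[mu]_(s in `[0%R, (rho - x)%R]) (g s)%:E +
   \int[mu]_(s in `[0%R, (rho + x)%R]) (g s)%:E)%E.
Proof.
move=> x0 xr cg ge; rewrite (@integral_segment_split _ _ 0)//; [|lra|lra].
rewrite -[in LHS]oppr0 -(opprB rho x) integral_even_opp ?oppr0//; last lra.
by rewrite (addrC x).
Qed.

Lemma integral_even_norm g x rho : 0 <= rho -> continuous g ->
  (forall s, g (- s) = g s) ->
  (\int[mu]_(s in `[(x - rho)%R, (x + rho)%R]) (g s)%:E =
   \int[mu]_(s in `[(`|x| - rho)%R, (`|x| + rho)%R]) (g s)%:E)%E.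
Proof.
move=> r0 cg ge; have [x0|x0] := leP 0 x; first by rewrite ger0_norm.
rewrite ltr0_norm// -integral_even_opp//; last lra.
by rewrite !opprD !opprK.
Qed.

(** Monotonicity of the integral for measurable functions, with no
    integrability: the convention [+oo - +oo = -oo] makes subtraction of
    extended reals monotone without side conditions. *)
Lemma le_integral_measurable (D : set R) (f1 f2 : R -> \bar R) :
  measurable D -> measurable_fun D f1 -> measurable_fun D f2 ->
  {in D, forall s, (f1 s <= f2 s)%E} ->
  (\int[mu]_(s in D) f1 s <= \int[mu]_(s in D) f2 s)%E.
Proof.
move=> mD m1 m2 f12; rewrite integralE [leRHS]integralE leeB//.
- apply: ge0_le_integral => //.
  + exact: measurable_funepos.
  + exact: measurable_funepos.
  + by move=> s /mem_set; exact: funepos_le.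
- apply: ge0_le_integral => //.
  + exact: measurable_funeneg.
  + exact: measurable_funeneg.
  + by move=> s /mem_set; exact: funeneg_le.
Qed.

End Integrals.

(** * The minimum principle *)

Section LowerSemicontinuous.
Local Set Implicit Arguments.
Local Unset Strict Implicit.
Context {X : topologicalType} {R : realType}.
Implicit Types (f : X -> \bar R) (g : X -> R) (K : set X).

Lemma lower_semicontinuous_compact_min f K : lower_semicontinuous f ->
  compact K -> K !=set0 -> exists2 x, K x & forall y, K y -> (f x <= f y)%E.
Proof.
move=> lscf cK [x0 Kx0].
pose i := ereal_inf (f @` K).
have ile y : K y -> (i <= f y)%E by move=> Ky; apply: ereal_inf_lbound; exists y.
have [[x Kx fxi]|noti] := pselect (exists2 x, K x & f x = i).
  by exists x => // y Ky; rewrite fxi; exact: ile.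
have ilt y : K y -> (i < f y)%E.
  by move=> Ky; rewrite lt_neqAle ile// andbT; apply/eqP => E; apply: noti; exists y.
(* near covering, for the filter of the real levels decreasing to the infimum *)
(* The superlevel sets [{f > q}], for real levels [q] decreasing to the
   infimum [i], form a near covering of [K]; one of them contains [K], which
   contradicts that [i] is the infimum. *)
pose F := filter_from [set q : R | (i < q%:E)%E]
  (fun q => [set p : R | (i < p%:E)%E /\ p <= q]).
have FF : Filter F.
  apply: filter_from_filter.
    have : (i < +oo)%E by apply: lt_le_trans (ilt _ Kx0) (leey _).
    case: (i) => [r| |]// _; last by exists 0; exact: ltNyr.
    by exists (r + 1); rewrite /= lte_fin ltrDl.
  move=> p q ip iq; exists (Num.min p q) => /=.
    by rewrite /Num.min; case: ifP.
  by move=> s [is_]; rewrite le_min => /andP[sp sq]; split; split.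
have cov : forall x, K x -> \forall x' \near x & q \near F, (q%:E < f x')%E.
  move=> x Kx.
  have [q iq qf] : exists2 q : R, (i < q%:E)%E & (q%:E < f x)%E.
    have := ilt _ Kx; case: (i) => [r| |]; case: (f x) => [s| |]//= rs.
    - exists ((r + s) / 2); rewrite lte_fin; move: rs; rewrite lte_fin; lra.
    - by exists (r + 1); rewrite ?ltry// lte_fin ltrDl.
    - by exists (s - 1); rewrite ?ltNyr// lte_fin gtrDl oppr_lt0.
    - by exists 0; rewrite ?ltNyr ?ltry.
  have [V xV Vf] := lscf _ _ qf.
  exists (V, [set p : R | (i < p%:E)%E /\ p <= q]); first by split => //=; exists q.
  by move=> [x' p] /= [Vx' [_ pq]]; apply: le_lt_trans (Vf _ Vx'); rewrite lee_fin.
have := @compact_near_coveringP _ K => -[/(_ cK) nc _].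
have [q /= iq qP] := nc _ F (fun q x => (q%:E < f x)%E) FF cov.
have : (q%:E <= i)%E.
  apply: le_ereal_inf_tmp => _ [y Ky <-]; apply/ltW.
  by apply: (qP q) => //; split.
by rewrite leNgt iq.
Qed.

Lemma lower_semicontinuousD_continuous f g : lower_semicontinuous f ->
  continuous g -> lower_semicontinuous (fun x => f x + (g x)%:E)%E.
Proof.
move=> lscf cg x a afg.
have [d d0 adf] : exists2 d : R, 0 < d & ((a - g x + d)%:E < f x)%E.
  move: afg; case: (f x) => [s| |]//=.
    rewrite -EFinD lte_fin => ags; exists ((s - (a - g x)) / 2); first lra.
    by rewrite lte_fin; lra.
  by move=> _; exists 1 => //; exact: ltry.
have [V xV Vf] := lscf _ _ adf.
exists (V `&` [set y | g x - d < g y]).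
  apply: filterI => //; apply: (cg x [set z | g x - d < z]).
  by apply: lt_nbhsr; lra.
move=> y [/Vf fy /= gy].
rewrite (_ : a = (a - g x + d) + (g x - d)); last by ring.
by rewrite EFinD; apply: lteD.
Qed.

End LowerSemicontinuous.

Section Minimum.
Local Set Implicit Arguments.
Local Unset Strict Implicit.
Context {R : realType}.
Local Notation mu := (@lebesgue_measure R).
Implicit Types (r h : R -> R) (f : R -> \bar R).

Lemma lower_semicontinuous_measurable_fun f (D : set R) : measurable D ->
  lower_semicontinuous f -> measurable_fun D f.
Proof.
by move=> mD lscf; apply: measurable_funTS; exact: lower_semicontinuous_measurable.
Qed.

(** The only way in which the supermedian property is used: [f] itself need not
    be integrable, but a real minorant with known integral bounds [f x] from
    below. *)
Lemma supermedian_minorant r f (q : R -> R) x I : 0 < r x ->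
  lower_semicontinuous f -> supermedian r f ->
  measurable_fun [set: R] (fun s => (q s)%:E) -> (forall s, (q s)%:E <= f s)%E ->
  (\int[mu]_(s in `[(x - r x)%R, (x + r x)%R]) (q s)%:E = I%:E)%E ->
  ((I / (2 * r x))%:E <= f x)%E.
Proof.
move=> rx lscf smf mq qf qI; apply: le_trans (smf x).
rewrite /interval_average [I / _]mulrC EFinM lee_pmul2l//; last first.
  by rewrite lte_fin invr_gt0 mulr_gt0.
rewrite -qI; apply: le_integral_measurable => //.
- exact: measurable_funTS.
- exact: lower_semicontinuous_measurable_fun.
Qed.

(** Minimum principle with barrier [h].  If [f y < m], choose [e] so small that
    [f y + e h y] is still below [m + e b], and minimize [f + e h].  The
    minimum is below all values on [|s| <= A], hence attained at some [x1]
    with [A <= |x1|]; there the average of [f + e h] is strictly below its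
    minimum, which is absurd. *)
Lemma supermedian_ge_min r f h (A b : R) (m : \bar R) : (forall x, 0 < r x) ->
  (forall x, -oo < f x)%E -> lower_semicontinuous f -> supermedian r f ->
  continuous h -> (forall s, b <= h s) ->
  (forall x, A <= `|x| -> exists2 I,
    (\int[mu]_(s in `[(x - r x)%R, (x + r x)%R]) (h s)%:E = I%:E)%E &
    I < 2 * r x * h x) ->
  (forall e v : R, 0 < e -> exists L : R, forall s, L < `|s| ->
    (v%:E < f s + (e * h s)%:E)%E) ->
  (forall s, `|s| <= A -> (m <= f s)%E) ->
  forall y, (m <= f y)%E.
Proof.
move=> r0 fNy lscf smf ch hb hI growth mA y.
rewrite leNgt; apply/negP => fym.
have [v0 fyE] : exists v0 : R, f y = v0%:E.
  by have := fNy y; move: fym; case: (f y) => [v0 _ _| |]//; [exists v0|case: m {mA}].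
have [m' v0m' m'm] : exists2 m' : R, v0 < m' & (m'%:E <= m)%E.
  move: fym; rewrite fyE; case: (m) => [m'| |]//; first by exists m'.
  by move=> _; exists (v0 + 1); [rewrite ltrDl|exact: leey].
have hy : 0 < h y - b + 1 by have := hb y; lra.
pose e := (m' - v0) / (h y - b + 1).
have e0 : 0 < e by rewrite divr_gt0// subr_gt0.
have eE : e * (h y - b) < m' - v0.
  rewrite -[ltRHS](divfK (lt0r_neq0 hy)) ltr_pM2l//; lra.
pose F : R -> \bar R := fun s => (f s + (e * h s)%:E)%E.
have lscF : lower_semicontinuous F.
  apply: lower_semicontinuousD_continuous => // s.
  by apply: cvgM; [exact: cvg_cst|exact: ch].
have FyE : F y = (v0 + e * h y)%:E by rewrite /F fyE.
have [L0 L0P] := growth e (v0 + e * h y) e0.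
pose L := Num.max L0 `|y|.
have yL : `[- L, L]%classic y by rewrite /= in_itv/= -ler_norml /L le_max lexx orbT.
have [x1 _ x1P] := lower_semicontinuous_compact_min lscF
  (@segment_compact _ (- L) L) (ex_intro _ y yL).
have x1min s : (F x1 <= F s)%E.
  have [sL|] := leP `|s| L; first by apply: x1P; rewrite /= in_itv/= -ler_norml.
  rewrite /L gt_max => /andP[/L0P sL _].
  by apply: (le_trans (x1P _ yL)); rewrite FyE; exact: ltW.
have [p FpE] : exists p : R, F x1 = p%:E.
  have := x1min y; rewrite FyE {1 2}/F; have := fNy x1.
  by case: (f x1) => [w _ _| |]//; exists (w + e * h x1).
have x1A : A <= `|x1|.
  rewrite leNgt; apply/negP => x1A.
  have : (m'%:E + (e * b)%:E <= F y)%E.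
    apply: le_trans (x1min y); apply: leeD.
      by apply: (le_trans m'm); apply: mA; exact: ltW.
    by rewrite lee_fin ler_pM2l.
  by rewrite FyE -EFinD lee_fin; lra.
have [I IE Ilt] := hI _ x1A.
have cq : continuous (fun s : R => p - e * h s).
  move=> s; apply: cvgB; first exact: cvg_cst.
  by apply: cvgM; [exact: cvg_cst|exact: ch].
have qI : (\int[mu]_(s in `[(x1 - r x1)%R, (x1 + r x1)%R]) (p - e * h s)%:E =
    (2 * r x1 * p - e * I)%:E)%E.
  have ih : mu.-integrable `[(x1 - r x1)%R, (x1 + r x1)%R] (EFin \o h).
    exact: integrable_segment.
  under eq_integral do rewrite EFinB EFinM.
  rewrite integralB//.
  - rewrite integral_segment_cst; last by have := r0 x1; lra.
    rewrite integralZl// IE -EFinM -EFinB; congr EFin; ring.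
  - exact: (@integrable_segment R (cst _) _ _ (@cst_continuous _ _ _)).
  - exact: integrableZl.
have rx1 := r0 x1.
have mq : measurable_fun [set: R] (fun s : R => (p - e * h s)%:E).
  by apply/measurable_EFinP; exact: continuous_measurable_fun.
have qf s : ((p - e * h s)%:E <= f s)%E.
  have := x1min s; rewrite FpE /F; case: (f s) (fNy s) => [w _|_ _|]//;
    last by rewrite leey.
    by rewrite -EFinD !lee_fin; lra.
have := supermedian_minorant (r0 x1) lscf smf mq qf qI.
have -> : f x1 = (p - e * h x1)%:E.
  move: FpE; rewrite /F; case: (f x1) => [w| |]//= [<-].
  by congr EFin; ring.
rewrite lee_fin ler_pdivrMr ?mulr_gt0//.
have : e * I < e * (2 * r x1 * h x1) by rewrite ltr_pM2l.
lra.
Qed.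

(** If [f y > m] somewhere in the interval, then [f] exceeds [m] by a positive
    constant on a subinterval, and the average of [f] exceeds [m]. *)
Lemma supermedian_min_near r f (m x : R) : 0 < r x ->
  lower_semicontinuous f -> supermedian r f ->
  (forall s, m%:E <= f s)%E -> f x = m%:E ->
  forall y, x - r x < y < x + r x -> f y = m%:E.
Proof.
move=> rx lscf smf mf fx y xy; apply/eqP; rewrite eq_le mf andbT leNgt.
apply/negP => mfy.
have [n n0 mnf] : exists2 n : R, 0 < n & ((m + n)%:E < f y)%E.
  move: mfy; case: (f y) => [s| |]//=.
    by rewrite lte_fin => ms; exists ((s - m) / 2); rewrite ?lte_fin; lra.
  by move=> _; exists 1 => //; exact: ltry.
have [V yV Vf] := lscf _ _ mnf.
have : nbhs y (V `&` `]x - r x, x + r x[%classic).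
  by apply: filterI => //; apply: near_in_itvoo; rewrite in_itv.
move=> /nbhs_ballP[d /= d0 dV].
pose B := `]y - d, y + d[%classic.
have BV : B `<=` V `&` `]x - r x, x + r x[%classic.
  by move=> s; rewrite /B -ball_itv; exact: dV.
have mB : measurable B by exact: measurable_itv.
have BD : B `&` `[x - r x, x + r x]%classic = B.
  by apply/setIidPl => s /BV[_]; exact: subset_itv_oo_cc.
have mi : measurable_fun [set: R] (fun s : R => n * \1_B s).
  by apply: measurable_funM => //; exact: measurable_indic.
have qI : (\int[mu]_(s in `[(x - r x)%R, (x + r x)%R]) (m + n * \1_B s)%:E =
    (2 * r x * m + n * (2 * d))%:E)%E.
  under eq_integral do rewrite EFinD EFinM.
  have ii : mu.-integrable `[(x - r x)%R, (x + r x)%R] (EFin \o (\1_B : R -> R)).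
    exact: (integrableS _ _ _ (integrable_indic_itv _ _ _ _)).
  rewrite integralD//.
  - rewrite integral_segment_cst; last by lra.
    rewrite integralZl// integral_indic// BD /B/= lebesgue_measure_itv/= lte_fin.
    rewrite ifT; last lra.
    rewrite -EFinB -EFinM -EFinD; congr EFin; ring.
  - exact: (@integrable_segment R (cst _) _ _ (@cst_continuous _ _ _)).
  - exact: integrableZl.
have qf s : ((m + n * \1_B s)%:E <= f s)%E.
  rewrite indicE; have [/set_mem/BV[/Vf fs _]|_] := boolP (s \in B).
    by rewrite mulr1; exact: ltW.
  by rewrite mulr0 addr0.
have mq : measurable_fun [set: R] (fun s : R => (m + n * \1_B s)%:E).
  by apply/measurable_EFinP; apply: measurable_funD.
have := supermedian_minorant rx lscf smf mq qf qI.
rewrite fx lee_fin ler_pdivrMr ?mulr_gt0//.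
have : 0 < n * d by rewrite mulr_gt0.
lra.
Qed.

Lemma supermedian_min_constant r f (m x0 : R) : (forall x, 0 < r x) ->
  lower_semicontinuous f -> supermedian r f ->
  (forall s, m%:E <= f s)%E -> f x0 = m%:E -> forall y, f y = m%:E.
Proof.
move=> r0 lscf smf mf fx0 y.
have cT : connected [set: R] by apply/connected_intervalP.
suff S : [set s | f s = m%:E] = [set: R] by have : [set: R] y by []; rewrite -S.
apply: cT; first by exists x0.
- exists [set s | f s = m%:E]; last by rewrite setTI.
  rewrite openE => x /= fx; apply: filterS (_ : nbhs x `]x - r x, x + r x[%classic).
    by move=> s; rewrite /= in_itv/=; exact: supermedian_min_near.
  by apply: near_in_itvoo; rewrite in_itv/=; have := r0 x; lra.
- exists (~` [set s | m%:E < f s]%E); last first.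
    rewrite setTI; apply/seteqP; split => s /=; first by move=> ->; rewrite ltxx.
    by move=> /negP; rewrite -leNgt => fs; apply/eqP; rewrite eq_le fs mf.
  by apply: open_closedC; move/lower_semicontinuousP : lscf; exact.
Qed.
End Minimum.

(** * Constancy up to the critical slope *)

Section Constancy.
Local Set Implicit Arguments.
Local Unset Strict Implicit.
Context {R : realType}.
Local Notation mu := (@lebesgue_measure R).
Implicit Types (x y a b rho : R) (f : R -> \bar R).

Lemma continuous_barrier y : -1 < y -> {for y, continuous (@barrier R)}.
Proof.
move=> y1.
have c1 : {for y, continuous (fun z : R => 1 + z)}.
  by apply: cvgD; [exact: cvg_cst|exact: cvg_id].
rewrite /barrier; apply: cvgB.
  by apply: (continuous_comp c1); apply: continuous_ln; lra.
apply: cvgM; first exact: cvg_cst.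
by apply: cvgV => //; rewrite gt_eqF//; lra.
Qed.

Lemma integral_barrier a b : 0 <= a -> a <= b ->
  (\int[mu]_(s in `[a, b]) (barrier `|s|)%:E =
   (barrier_prim b - barrier_prim a)%:E)%E.
Proof.
move=> a0 ab; rewrite -(@integral_segment _ barrier barrier_prim a b)//.
- apply: eq_integral => s /set_mem /=; rewrite in_itv/= => /andP[as_ _].
  by rewrite ger0_norm//; lra.
- move=> y; rewrite in_itv/= => /andP[ay _].
  by apply: is_derive_barrier_prim; lra.
- apply: continuous_in_subspaceT => y; rewrite inE/= in_itv/= => /andP[ay _].
  by apply: continuous_barrier; lra.
Qed.

Lemma continuous_barrier_norm : continuous (fun s : R => barrier `|s|).
Proof.
move=> s; apply: (continuous_comp (@norm_continuous _ _ s)).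
by apply: continuous_barrier; have := normr_ge0 s; lra.
Qed.

Lemma integral_barrier_norm x rho : 0 < rho ->
  (\int[mu]_(s in `[(x - rho)%R, (x + rho)%R]) (barrier `|s|)%:E =
   (barrier_integral `|x| rho)%:E)%E.
Proof.
move=> r0; have ev s : barrier `|- s : R| = barrier `|s| by rewrite normrN.
rewrite (@integral_even_norm _ (fun s => barrier `|s|) x rho (ltW r0)
  continuous_barrier_norm ev) /barrier_integral.
have x0 := normr_ge0 x.
have [rx|xr] := leP rho `|x|; first by rewrite integral_barrier//; lra.
rewrite (@integral_even_split _ (fun s => barrier `|s|) `|x| rho x0 (ltW xr)
  continuous_barrier_norm ev).
have P0 : barrier_prim (0 : R) = 0.
  by rewrite /barrier_prim addr0 ln1 mulr0 subr0.
rewrite !integral_barrier ?P0 ?subr0 -?EFinD//; [|lra|lra].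
by congr EFin; ring.
Qed.

Lemma barrier_norm_ge x : -2 <= barrier `|x|.
Proof.
have x0 := normr_ge0 x; rewrite /barrier.
have : 0 <= ln (1 + `|x|) by apply: ln_ge0; lra.
have : 2 / (1 + `|x|) <= 2 by rewrite ler_pdivrMr; lra.
lra.
Qed.

Lemma barrier_norm_ge_ln x : x != 0 -> ln `|x| - 2 <= barrier `|x|.
Proof.
rewrite -normr_gt0 => x0; rewrite /barrier.
have : ln `|x| <= ln (1 + `|x|) by rewrite ler_ln ?posrE//; lra.
have : 2 / (1 + `|x|) <= 2 by rewrite ler_pdivrMr; lra.
lra.
Qed.

Lemma ln_gt_of_expR_lt a y : expR a < y -> a < ln y.
Proof.
move=> ay; rewrite -[ltLHS]expRK ltr_ln ?posrE ?expR_gt0//.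
exact: lt_trans (expR_gt0 _) ay.
Qed.

(** The inferior limit of [f x / ln |x|] at infinity is nonnegative, in a form
    free of division. *)
Definition log_lower_bound f :=
  forall e : R, 0 < e -> exists A : R, forall s : R, A < `|s| ->
    ((- (e * ln `|s|))%:E <= f s)%E.

Lemma lower_bounded_log_lower_bound f (m : R) : (forall x, (m%:E <= f x)%E) ->
  log_lower_bound f.
Proof.
move=> mf e e0; exists (expR (`|m| / e)) => s /ln_gt_of_expR_lt.
rewrite ltr_pdivrMr// mulrC => ls; apply: le_trans (mf s); rewrite lee_fin.
by have := ler_norm (- m); rewrite normrN; lra.
Qed.

Lemma liminf_log_lower_bound f :
  (0 <= limf_einf (fun x : R => f x / (ln `|x|)%:E) (norm_pinfty_nbhs R))%E ->
  log_lower_bound f.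
Proof.
move=> lf e e0.
have : ((- e)%:E < limf_einf (fun x : R => f x / (ln `|x|)%:E) (norm_pinfty_nbhs R))%E.
  by apply: lt_le_trans lf; rewrite lte_fin oppr_lt0.
rewrite limf_einfE => /ereal_sup_gt[_ [V [A _ AV] <-] eV].
exists (Num.max A 1) => s; rewrite gt_max => /andP[As s1].
have ls : 0 < ln `|s| by apply: ln_gt0.
have : ((- e)%:E < f s / (ln `|s|)%:E)%E.
  by apply: lt_le_trans eV _; apply: ereal_inf_lbound; exists s => //; apply: AV.
rewrite inver gt_eqF// -mulNr EFinM => H.
have : ((- e)%:E * (ln `|s|)%:E <= f s * (ln `|s|)^-1%:E * (ln `|s|)%:E)%E.
  by rewrite lee_pmul2r// ?ltW// lte_fin.
rewrite -muleA -[in leRHS]EFinM mulVf ?mule1 ?gt_eqF//.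
Qed.

(** Half of the barrier term compensates [f], the other half tends to
    infinity. *)
Lemma barrier_growth f : log_lower_bound f -> forall e v : R, 0 < e ->
  exists L : R, forall s : R, L < `|s| -> (v%:E < f s + (e * barrier `|s|)%:E)%E.
Proof.
move=> lf e v e0; have [A AP] := lf (e / 2) ltac:(lra).
exists (Num.max A (expR (2 * (v + 2 * e) / e))) => s; rewrite gt_max => /andP[As].
move=> es; have ls := ln_gt_of_expR_lt es.
have s0 : s != 0 by rewrite -normr_gt0; exact: lt_trans (expR_gt0 _) es.
have hs := barrier_norm_ge_ln s0.
have ehs : e * (ln `|s| - 2) <= e * barrier `|s| by rewrite ler_pM2l.
move: ls; rewrite ltr_pdivrMr// => ls.
apply: lt_le_trans (leeD (AP _ As) (_ : (e * (ln `|s| - 2))%:E <= _)%E).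
  by rewrite -EFinD lte_fin; lra.
by rewrite lee_fin.
Qed.

Lemma supermedian_constant (c0 M : R) (r : R -> R) f :
  2 < c0 -> c0 < 3 -> log_excess c0 = 0 ->
  (forall x, 0 < r x) -> 0 < M ->
  (forall x : R, x \notin `[- M, M] -> r x <= c0 * `|x| + M) ->
  (forall x, (-oo < f x)%E) -> lower_semicontinuous f -> supermedian r f ->
  log_lower_bound f -> exists k : \bar R, forall x, f x = k.
Proof.
move=> c2 c3 c0E r0 M0 rM fNy lscf smf lf.
have [A0 A0P] := @barrier_integral_lt R c0 M c2 c3 c0E M0.
pose A := Num.max A0 (M + 1).
have A00 : `[- A, A]%classic (0 : R).
  by rewrite /= in_itv/= -ler_norml normr0 le_max; apply/orP; right; lra.
have [x0 _ x0P] := lower_semicontinuous_compact_min lscf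
  (@segment_compact _ (- A) A) (ex_intro _ _ A00).
have fx0 y : (f x0 <= f y)%E.
  apply: (@supermedian_ge_min R r f (fun s => barrier `|s|) A (-2)) => //.
  - exact: continuous_barrier_norm.
  - exact: barrier_norm_ge.
  - move=> x; rewrite ge_max => /andP[A0x Mx].
    exists (barrier_integral `|x| (r x)); first exact: integral_barrier_norm.
    apply: A0P => //; apply: rM; rewrite in_itv/= -ler_norml -ltNge; lra.
  - exact: barrier_growth.
  - by move=> s sA; apply: x0P; rewrite /= in_itv/= -ler_norml.
case E : (f x0) (fNy x0) => [m| |]// _.
- exists m%:E; apply: (@supermedian_min_constant R r f m x0) => // s.
  by rewrite -E.
- by exists +oo%E => y; apply/eqP; rewrite -leye_eq -E.
Qed.

End Constancy.

(** * Power functions above the critical slope *)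

Section PowerSupermedian.
Local Set Implicit Arguments.
Local Unset Strict Implicit.
Context {R : realType}.
Local Notation mu := (@lebesgue_measure R).
Implicit Types (c M al x y : R).

Lemma ler_powRN al x y : 0 <= al -> 0 < x -> x <= y -> y `^ (- al) <= x `^ (- al).
Proof.
move=> al0 x0 xy; rewrite !powRN lef_pV2 ?posrE ?powR_gt0//; last lra.
by apply: ge0_ler_powR => //; rewrite nnegrE; lra.
Qed.

Lemma powR_onem x al : 0 < x -> x `^ (1 - al) = x * x `^ (- al).
Proof.
by move=> x0; rewrite powRD ?powRr1 ?ltW//; apply/implyP => _; rewrite gt_eqF.
Qed.

(** From [exp (- x) >= 1 - x] and [(1 - x) (1 + x + 2 x ^ 2) >= 1]. *)
Lemma expR_le_quadratic x : x <= 2^-1 -> expR x <= 1 + x + 2 * x ^+ 2.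
Proof.
move=> x2; have h := expR_ge1Dx (- x); rewrite expRN in h.
have e0 := expR_gt0 x.
have : expR x * (1 - x) <= 1.
  by rewrite -[leRHS](divff (lt0r_neq0 e0)) ler_pM2l.
have : 0 <= x ^+ 2 * (1 - 2 * x) by rewrite mulr_ge0 ?sqr_ge0//; lra.
move=> h1 h2; rewrite -(@ler_pM2r _ (1 - x)); lra.
Qed.

Lemma powR_onem_le x al : 0 < x -> - (al * ln x) <= 2^-1 ->
  x `^ (1 - al) <= x - al * (x * ln x) + 2 * al ^+ 2 * (x * ln x ^+ 2).
Proof.
move=> x0 lx; rewrite powR_onem// /powR gt_eqF// mulNr.
have := expR_le_quadratic lx; rewrite -(ler_pM2l x0); lra.
Qed.

(** Expanding to second order in [al], the left side is at most
    [2 c - al (log_excess c + 2 c) + 2 al ^ 2 Q] with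
    [Q = (c + 1) ln (c + 1) ^ 2 + (c - 1) ln (c - 1) ^ 2].  The four summands
    of [D] make [al < 1], make both expansions valid, and make the quadratic
    term smaller than the gain [al * log_excess c]. *)
Lemma powR_average_le c : 1 < c -> 0 < log_excess c ->
  exists2 al0 : R, 0 < al0 < 1 & forall al, 0 < al -> al <= al0 ->
    (c + 1) `^ (1 - al) + (c - 1) `^ (1 - al) <= 2 * c * (1 - al).
Proof.
move=> c1 g0; set l1 := ln (c + 1); set l2 := ln (c - 1).
pose Q := (c + 1) * l1 ^+ 2 + (c - 1) * l2 ^+ 2.
have Q0 : 0 <= Q by rewrite /Q addr_ge0// mulr_ge0 ?sqr_ge0//; lra.
pose q := 2 * Q / log_excess c.
have q0 : 0 <= q by rewrite divr_ge0 ?(ltW g0)// mulr_ge0.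
have n1 := normr_ge0 l1; have n2 := normr_ge0 l2.
pose D := 2 + 2 * `|l1| + 2 * `|l2| + q.
have D0 : 0 < D by rewrite /D; lra.
exists D^-1; first by rewrite invr_gt0 D0 invf_lt1//= /D; lra.
move=> al al0; rewrite -[D^-1]mul1r ler_pdivlMr// => alD.
have a1 : 0 <= al * `|l1| by rewrite mulr_ge0// ltW.
have a2 : 0 <= al * `|l2| by rewrite mulr_ge0// ltW.
have aq : 0 <= al * q by rewrite mulr_ge0// ltW.
move: alD; rewrite /D !mulrDr => alD.
have b1 : - (al * l1) <= 2^-1.
  have : al * - l1 <= al * `|l1| by rewrite ler_pM2l// -normrN ler_norm.
  lra.
have b2 : - (al * l2) <= 2^-1.
  have : al * - l2 <= al * `|l2| by rewrite ler_pM2l// -normrN ler_norm.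
  lra.
have h1 := @powR_onem_le (c + 1) al ltac:(lra) b1.
have h2 := @powR_onem_le (c - 1) al ltac:(lra) b2.
have h3 : al * (al * (2 * Q)) <= al * log_excess c.
  rewrite ler_pM2l// -[log_excess c]mul1r -ler_pdivrMr// -mulrA -/q; lra.
move: h1 h2 h3; rewrite -/l1 -/l2 /Q /log_excess -/l1 -/l2; lra.
Qed.

Definition power_profile c M al (s : R) := Num.max (c * `|s|) M `^ (- al).

Lemma continuous_powR al y : 0 < y -> {for y, continuous (fun z : R => z `^ al)}.
Proof.
move=> y0; apply/differentiable_continuous/derivable1_diffP.
by have [] := is_derive1_powR al y0.
Qed.

Lemma continuous_power_profile c M al : 0 < M -> continuous (power_profile c M al).
Proof.
move=> M0 s.
have cm : {for s, continuous (fun z : R => Num.max (c * `|z|) M)}.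
  have cn : {for s, continuous (fun z : R => c * `|z|)}.
    by apply: cvgM; [exact: cvg_cst|exact: norm_continuous].
  exact: (@continuous_max _ _ (fun z : R => c * `|z|) (cst M) s cn (cvg_cst _)).
apply: (@continuous_comp _ _ _ _ (fun z : R => z `^ (- al)) s cm).
apply: continuous_powR; by rewrite lt_max M0 orbT.
Qed.

Lemma is_derive_power_prim c al y : 0 < c -> 0 < y -> al < 1 ->
  is_derive y 1 (fun z : R => (c * z) `^ (1 - al) / (c * (1 - al)))
    ((c * y) `^ (- al)).
Proof.
move=> c0 y0 al1.
have cy : 0 < c * y by rewrite mulr_gt0.
have d1 : is_derive y 1 (fun z : R => c * z) c.
  have := is_deriveM (is_derive_cst c y 1) (is_derive_id y 1).
  by move/is_derive_eq; apply; rewrite /GRing.scale/= mulr0 addr0 mulr1.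
have d2 := @is_derive1_powR R (1 - al) _ cy.
have d3 := @is_derive1_comp R (fun z => z `^ (1 - al)) (fun z : R => c * z) y _ _ d2 d1.
have := is_deriveM d3 (is_derive_cst ((c * (1 - al))^-1) y 1).
move/is_derive_eq; apply; rewrite /GRing.scale/= mulr0 add0r.
rewrite (_ : 1 - al - 1 = - al); last by ring.
by field; rewrite !gt_eqF//; lra.
Qed.

(** The right side is the integral of the singular function
    [(c s) ^ (- al)], which dominates the profile; as the profile is constant
    up to [M / c] and equal to the singular function beyond, no improper
    integral is involved. *)
Lemma integral_power_profile_le c M al y : 0 < c -> 0 < M -> 0 < al < 1 -> 0 < y ->
  (\int[mu]_(s in `[0%R, y]) (power_profile c M al s)%:E <=
   ((c * y) `^ (1 - al) / (c * (1 - al)))%:E)%E.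
Proof.
move=> c0 M0 /andP[al0 al1] y0.
pose Psi (z : R) := (c * z) `^ (1 - al) / (c * (1 - al)).
have small z : 0 < z -> c * z <= M ->
    (\int[mu]_(s in `[0%R, z]) (power_profile c M al s)%:E <= (Psi z)%:E)%E.
  move=> z0 cz.
  have cz0 : 0 < c * z by rewrite mulr_gt0.
  rewrite (_ : \int[mu]_(s in _) _ = \int[mu]_(s in `[0%R, z]) (M `^ (- al))%:E)%E.
    rewrite integral_segment_cst ?subr0; last exact: ltW.
    rewrite lee_fin /Psi powR_onem// invfM.
    have -> : c * z * (c * z) `^ (- al) * (c^-1 / (1 - al)) =
        z * (c * z) `^ (- al) / (1 - al).
      by field; rewrite !gt_eqF//; lra.
    rewrite ler_pdivlMr; last lra.
    have h := ler_powRN (ltW al0) cz0 cz.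
    have : M `^ (- al) * z <= (c * z) `^ (- al) * z by rewrite ler_pM2r.
    have p0 : 0 <= al * (M `^ (- al) * z) by rewrite !mulr_ge0 ?powR_ge0// ltW.
    lra.
  apply: eq_integral => s /set_mem/=; rewrite in_itv/= => /andP[s0 sz].
  rewrite /power_profile ger0_norm// max_r//; apply: le_trans cz.
  by rewrite ler_pM2l.
have [cyM|Mcy] := leP (c * y) M; first exact: small.
pose d := M / c.
have d0 : 0 < d by rewrite divr_gt0.
have cd : c * d = M by rewrite mulrC divfK// gt_eqF.
have dy : d <= y by rewrite ler_pdivrMr// mulrC ltW.
rewrite (@integral_segment_split _ _ 0 d)//;
  [|exact: ltW|exact: continuous_power_profile].
have -> : (\int[mu]_(s in `[d, y]) (power_profile c M al s)%:E =
           (Psi y - Psi d)%:E)%E.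
  rewrite -(@integral_segment _ (fun s => (c * s) `^ (- al)) Psi)//.
  - apply: eq_integral => s /set_mem/=; rewrite in_itv/= => /andP[ds _].
    have s0 : 0 < s by apply: lt_le_trans ds.
    by rewrite /power_profile gtr0_norm// max_l// -cd ler_pM2l.
  - move=> s; rewrite in_itv/= => /andP[ds _]; apply: is_derive_power_prim => //.
    by apply: lt_le_trans ds.
  - apply: continuous_in_subspaceT => s; rewrite inE/= in_itv/= => /andP[ds _].
    have cs : {for s, continuous (fun z : R => c * z)}.
      by apply: cvgM; [exact: cvg_cst|exact: cvg_id].
    apply: (@continuous_comp _ _ _ _ (fun z : R => z `^ (- al)) s cs).
    apply: continuous_powR; by rewrite mulr_gt0//; apply: lt_le_trans ds.
rewrite (_ : _ / _ = Psi d + (Psi y - Psi d)); last by rewrite [RHS]addrC subrK.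
by rewrite [leRHS]EFinD; apply: leeD2r; apply: small; rewrite ?cd.
Qed.

(** Where the radius is [M] the profile takes its maximum [M ^ (- al)].
    Elsewhere the two pieces [[0, (c - 1) |x|]] and [[0, (c + 1) |x|]] of the
    folded interval scale to the two powers in the hypothesis. *)
Lemma power_profile_supermedian c M al : 1 < c -> 0 < M -> 0 < al < 1 ->
  (c + 1) `^ (1 - al) + (c - 1) `^ (1 - al) <= 2 * c * (1 - al) ->
  supermedian (fun x => Num.max (c * `|x|) M) (fun x => (power_profile c M al x)%:E).
Proof.
move=> c1 M0 al01 avg x; have /andP[al0 al1] := al01.
rewrite /interval_average; set rho := Num.max _ _.
have Mrho : M <= rho by rewrite le_max lexx orbT.
have rho0 : 0 < rho by lra.
have ppx : power_profile c M al x = rho `^ (- al) by [].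
have cp : continuous (power_profile c M al) by exact: continuous_power_profile.
have mp : measurable_fun [set: R] (fun s => (power_profile c M al s)%:E).
  by apply/measurable_EFinP; exact: continuous_measurable_fun.
rewrite (_ : (power_profile c M al x)%:E =
  ((2 * rho)^-1%:E * (2 * rho * power_profile c M al x)%:E)%E); last first.
  by rewrite -EFinM mulKf// gt_eqF// mulr_gt0.
rewrite lee_pmul2l//; last by rewrite lte_fin invr_gt0 mulr_gt0.
have [cxM|Mcx] := leP (c * `|x|) M.
  have rhoM : rho = M by rewrite /rho max_r.
  apply: (@le_trans _ _
    (\int[mu]_(s in `[(x - rho)%R, (x + rho)%R]) (M `^ (- al))%:E)%E).
    apply: le_integral_measurable => //; first exact: measurable_funTS.
    move=> s _; rewrite lee_fin; apply: ler_powRN => //; first exact: ltW.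
    by rewrite le_max lexx orbT.
  rewrite integral_segment_cst; last lra.
  rewrite lee_fin ppx rhoM; lra.
have x0 : 0 < `|x|.
  rewrite -(@ltr_pM2l _ c) ?mulr0; lra.
have rhox : rho = c * `|x| by rewrite /rho max_l// ltW.
have ev s : power_profile c M al (- s) = power_profile c M al s.
  by rewrite /power_profile normrN.
have xrho : `|x| < rho by rewrite rhox ltr_pMl.
rewrite integral_even_norm//; last exact: ltW.
rewrite integral_even_split//; [|exact: ltW].
have c0 : 0 < c by lra.
have y1 : 0 < rho - `|x| by lra.
have y2 : 0 < rho + `|x| by lra.
apply: (le_trans (leeD (integral_power_profile_le c0 M0 al01 y1)
                       (integral_power_profile_le c0 M0 al01 y2))).
rewrite -EFinD lee_fin ppx rhox.
have -> : c * `|x| - `|x| = `|x| * (c - 1) by ring.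
have -> : c * `|x| + `|x| = `|x| * (c + 1) by ring.
have cx0 : 0 < c * `|x| by lra.
rewrite !mulrA !(@powRM R (c * `|x|)); [|lra|lra|lra|lra].
rewrite -mulrDl -mulrDr ler_pdivrMr; last by rewrite mulr_gt0; lra.
rewrite powR_onem//.
have p0 := powR_gt0 (- al) cx0.
have : c * `|x| * (c * `|x|) `^ (- al) * ((c + 1) `^ (1 - al) + (c - 1) `^ (1 - al))
   <= c * `|x| * (c * `|x|) `^ (- al) * (2 * c * (1 - al)).
  by rewrite ler_pM2l// mulr_gt0.
lra.
Qed.

End PowerSupermedian.

(** * The dichotomy *)

Theorem proposition1p4 (R : realType) :
  exists c0 : R,
    [/\ unique (fun t : R => 1 < t /\ critical_equation t) c0,
        forall (r : R -> R) (M : R),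
          (forall x, 0 < r x) -> 0 < M ->
          (forall x : R, x \notin `[- M, M] -> r x <= c0 * `|x| + M) ->
          forall f : R -> \bar R,
            (forall x, (-oo < f x)%E) ->
            lower_semicontinuous f ->
            supermedian r f ->
            (exists m : R, forall x, (m%:E <= f x)%E) \/
            (0 <= limf_einf (fun x : R => f x / (ln `|x|)%:E)
                    (norm_pinfty_nbhs R))%E ->
            exists k : \bar R, forall x, f x = k
      & forall c M : R,
          c0 < c -> 0 < M ->
          let r := fun x : R => Num.max (c * `|x|) M in
          exists2 alpha0 : R, 0 < alpha0 &
            forall alpha : R, 0 < alpha -> alpha <= alpha0 ->
              supermedian r (fun x : R => (r x `^ (- alpha))%:E)].
Proof.
have [c0 [c2 c3 c0E]] := @critical_root R.
exists c0; split.
- split; first by split; [lra|exact/log_excess_eq0].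
  move=> t [t1 /log_excess_eq0 tE].
  have [t2|t2] := leP t 2; first by have := log_excess_lt0 t t1 t2; rewrite tE ltxx.
  have [tc|ct|//] := ltgtP t c0.
    by have := log_excess_lt t c0 (ltW t2) tc; rewrite tE c0E ltxx.
  by have := log_excess_lt c0 t (ltW c2) ct; rewrite tE c0E ltxx.
- move=> r M r0 M0 rM f fNy lscf smf bf.
  apply: (@supermedian_constant R c0 M r f) => //.
  case: bf => [[m mf]|lf]; first exact: lower_bounded_log_lower_bound mf.
  exact: liminf_log_lower_bound.
- move=> c M c0c M0 r.
  have g0 : 0 < log_excess c by rewrite -c0E; apply: log_excess_lt; lra.
  have [al0 /andP[al00 al01] alP] := @powR_average_le R c ltac:(lra) g0.
  exists al0 => // al al_gt0 al_le.
  apply: (@power_profile_supermedian R c M al) => //; first lra.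
    by rewrite al_gt0 (le_lt_trans al_le).
  exact: alP.
Qed.
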